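(* Let $p$ be a prime and define a binary operation $\oplus$ on $\mathbb Z$ by $$a\oplus b = \begin{cases} p\left(\left\lfloor \frac{a}{p^2}\right\rfloor+\left\lfloor\frac{b}{p^2}\right\rfloor\right) & \text{if } p\mid a+b \text{ and } p\nmid a,\\ a+b & \text{in every other case.}\end{cases}$$ Let $Q$ be an infinite loop (with unit $1$) whose underlying set is partitioned into subsets $Q_i$, $i\in\mathbb Z_p$, all of the same cardinality. For each $i\in\mathbb Z_p$ choose a bijection $\pi_i\colon Q\to Q_i$, and for $a\in\mathbb Z$ set $\pi_a=\pi_i$ whenever $a\equiv i \pmod p$. Define an operation $\cdot$ on $\mathbb Z\times Q$ by $$(a,x)(b,y)=\begin{cases}\bigl(a\oplus b,\ \pi_{\frac{a+b-p}{p}}(xy)\bigr) & \text{if } p\mid a+b\text{ and } p\nmid a,\\ (a\oplus b,\ xy)=(a+b,\ xy) & \text{in every other case.}\end{cases}$$ Then $M=(\mathbb Z\times Q,\cdot)$ is a loop with unit $(0,1)$; the relation $(a,x)\sim(b,y)\iff a=b$ is a multiplicative equivalence on $M$; the class $S=[(0,1)]_\sim=\{0\}\times Q$ is a subloop of $M$ that is not a normal subloop of $M$; every standard generator $\varphi$ of $\operatorname{Inn} M$ satisfies $\varphi(S)\subseteq S$; and there exists a standard generator $\varphi$ of $\operatorname{Inn} M$ such that $\varphi(S)\neq S$. Moreover, if $Q$ is commutative, then $M$ is commutative.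
   Context: A loop is a set with a binary operation with a two-sided unit such that all left translations $L_x\colon y\mapsto xy$ and right translations $R_x\colon y\mapsto yx$ are bijections. The multiplication group of a loop $M$ is $\operatorname{Mlt} M=\langle L_x,R_x;\ x\in M\rangle$, and the inner mapping group $\operatorname{Inn} M$ is the stabilizer of the unit in $\operatorname{Mlt}M$. The standard generators of $\operatorname{Inn} M$ are the mappings $L_{xy}^{-1}L_xL_y$, $R_{yx}^{-1}R_xR_y$ and $L_x^{-1}R_x$ with $x,y\in M$ (maps are composed right to left). A subloop $S$ of $M$ is normal iff $\varphi(S)=S$ for all $\varphi\in\operatorname{Inn}M$. An equivalence $\sim$ on a loop $M$ is multiplicative if $x\sim y$ and $u\sim v$ imply $xu\sim yv$, for all $x,y,u,v\in M$. Here $\lfloor\cdot\rfloor$ denotes the integer part (floor), and $\mathbb Z_p$ denotes the integers modulo $p$. *)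

(* Defs.v *)
From HB Require Import structures.
From mathcomp Require Import all_boot all_order all_algebra.
From mathcomp Require Import boolp classical_sets functions cardinality.

Set Implicit Arguments.
Unset Strict Implicit.
Unset Printing Implicit Defensive.

Import Order.TTheory GRing.Theory Num.Theory.

Local Open Scope classical_set_scope.
Local Open Scope ring_scope.

Section Loops.
Variables (T : Type) (mul : T -> T -> T) (e : T).

Definition ltrans (x : T) : T -> T := fun y => mul x y.
Definition rtrans (x : T) : T -> T := fun y => mul y x.

Definition is_loop : Prop :=
  [/\ left_id e mul, right_id e mul,
      forall x, bijective (ltrans x) & forall x, bijective (rtrans x)].

(* The inverse map of a bijection f : T -> T (junk values otherwise). *)
Definition inv_map (f : T -> T) : T -> T := 'pinv_id [set: T] f.

(* The subgroup of Sym(T) generated by the translations; it is only meaningful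
   when they are bijections, i.e. when (T, mul, e) is a loop. *)
Inductive Mlt : (T -> T) -> Prop :=
| Mlt_ltrans x : Mlt (ltrans x)
| Mlt_rtrans x : Mlt (rtrans x)
| Mlt_id : Mlt id
| Mlt_comp f g : Mlt f -> Mlt g -> Mlt (f \o g)
| Mlt_inv f : Mlt f -> Mlt (inv_map f).

Definition Inn (f : T -> T) : Prop := Mlt f /\ f e = e.

Inductive Inn_std_generator : (T -> T) -> Prop :=
| Inn_std_L x y :
    Inn_std_generator (inv_map (ltrans (mul x y)) \o ltrans x \o ltrans y)
| Inn_std_R x y :
    Inn_std_generator (inv_map (rtrans (mul y x)) \o rtrans x \o rtrans y)
| Inn_std_T x :
    Inn_std_generator (inv_map (ltrans x) \o rtrans x).

(* S is a loop under the restriction of mul (its unit is then that of T);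
   set_bij S S includes closure of S under the translations by its elements. *)
Definition is_subloop (S : set T) : Prop :=
  [/\ S e, forall x, S x -> set_bij S S (ltrans x)
         & forall x, S x -> set_bij S S (rtrans x)].

Definition is_normal_subloop (S : set T) : Prop :=
  is_subloop S /\ forall phi, Inn phi -> phi @` S = S.

Definition multiplicative_equivalence (R : T -> T -> Prop) : Prop :=
  RelationClasses.Equivalence R /\
  forall x y u v, R x y -> R u v -> R (mul x u) (mul y v).

End Loops.

Definition eq_class (T : Type) (R : T -> T -> Prop) (x : T) : set T :=
  [set y | R x y].

Section Construction.
Variable p : nat.

Definition carry (a b : int) : bool := (p %| a + b)%Z && ~~ (p %| a)%Z.

(* For a positive divisor, intdiv's quotient rounds towards -oo, so that
   (a %/ p^2)%Z is the integer part of a / p^2. *)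
Definition oplus (a b : int) : int :=
  if carry a b then p%:Z * ((a %/ p%:Z ^+ 2)%Z + (b %/ p%:Z ^+ 2)%Z)
  else a + b.

Variables (Q : Type) (qmul : Q -> Q -> Q) (pi : 'F_p -> Q -> Q).

(* pi_a for an integer a: the index is the residue class of a. *)
Definition pi_int (a : int) : Q -> Q := pi a%:~R.

Definition Mmul (u v : int * Q) : int * Q :=
  if carry u.1 v.1
  then (oplus u.1 v.1,
        pi_int ((u.1 + v.1 - p%:Z) %/ p%:Z)%Z (qmul u.2 v.2))
  else (oplus u.1 v.1, qmul u.2 v.2).

End Construction.

Definition Msim (Q : Type) (u v : int * Q) : Prop := u.1 = v.1.

(* Main.v *)
Require Import Defs.
From HB Require Import structures.
From mathcomp Require Import all_boot all_order all_algebra.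
From mathcomp Require Import boolp classical_sets functions cardinality.
From mathcomp Require Import ring.

Set Implicit Arguments.
Unset Strict Implicit.
Unset Printing Implicit Defensive.

Import Order.TTheory GRing.Theory Num.Theory.

Local Open Scope classical_set_scope.
Local Open Scope card_scope.
Local Open Scope ring_scope.

(** The first coordinate is a morphism from M onto the magma of integers
under the twisted sum [oplus], and two facts about that magma drive
everything.

The twisted sum d (+) c = d only has the solution c = 0 ([oplus_eql]): a twist
would make d (+) c a multiple of p while d is not one, and an ordinary sum d + c = d forces c = 0.  A standard generator
phi solves an equation such as (uv) phi(s) = u (v s), so for s in the fibre S
over 0 the first coordinate c of phi(s) satisfies d (+) c = d, where d is the
first coordinate of uv.  Hence phi(S) lies in S
([Inn_std_generator_compat], [std_generator_Msim_class]).

On the other hand [oplus] is not cancellative.  If p divides c but not a, the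
solutions b of a (+) b = c are the numbers b = p (t + 1) - a with a prescribed
floor of b / p^2.  Shifting t by p s shifts b by p^2 s and that floor by s, so
there is exactly one solution for each residue of t modulo p ([carry_inj],
[carry_onto]).  The operation of M maps the product in Q to the block with
index t = (a + b - p) / p; as the blocks partition Q, the second coordinate of
the right-hand side selects one of the p solutions, and translations of M are
bijective ([Mmul_ltrans_bij]).

For the strict inclusion, take u and v over 1 and -1.  Then u (v S) only
contains elements whose second coordinate lies in one block, whereas
(uv) S is the whole fibre over 1 (+) -1.  Since p > 1 there is another block,
so the generator sending s to (uv) \ (u (v s)) maps S to a proper subset of
itself ([std_generator_shrinks_class]); as this generator belongs to the inner
mapping group, S is not normal. *)

(** * Inner mappings of a loop *)

Lemma inj_surj_bijective (U V : Type) (f : U -> V) :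
  injective f -> (forall z, exists w, f w = z) -> bijective f.
Proof.
move=> f_inj f_surj; rewrite -setTT_bijective; split=> //.
- by move=> x y _ _; apply: f_inj.
- by move=> z _; have [w <-] := f_surj z; exists w.
Qed.

Section LoopFacts.
Variables (T : Type) (mul : T -> T -> T) (e : T).

Lemma inv_mapK (f : T -> T) : bijective f -> cancel f (inv_map f).
Proof.
move=> f_bij x; rewrite /inv_map pinvKV ?inE //.
by move=> y z _ _; apply: (bij_inj f_bij).
Qed.

Lemma inv_mapVK (f : T -> T) : bijective f -> cancel (inv_map f) f.
Proof. by move=> f_bij x; have [g _ gK] := f_bij; rewrite -[x]gK inv_mapK. Qed.

Hypothesis T_loop : is_loop mul e.

Lemma Inn_std_generator_Inn phi : Inn_std_generator mul phi -> Inn mul e phi.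
Proof.
have [mul1x mulx1 Lbij Rbij] := T_loop.
have invLK x : cancel (ltrans mul x) (inv_map (ltrans mul x)) := inv_mapK (Lbij x).
have invRK x : cancel (rtrans mul x) (inv_map (rtrans mul x)) := inv_mapK (Rbij x).
case=> [x y|x y|x]; split.
- apply: Mlt_comp; last exact: Mlt_ltrans.
  by apply: Mlt_comp; [apply: Mlt_inv|]; apply: Mlt_ltrans.
- by rewrite -[RHS](invLK (mul x y)) /= /ltrans !mulx1.
- apply: Mlt_comp; last exact: Mlt_rtrans.
  by apply: Mlt_comp; [apply: Mlt_inv|]; apply: Mlt_rtrans.
- by rewrite -[RHS](invRK (mul y x)) /= /rtrans !mul1x.
- by apply: Mlt_comp; [apply: Mlt_inv; apply: Mlt_ltrans | apply: Mlt_rtrans].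
- by rewrite -[RHS](invLK x) /= /ltrans /rtrans mulx1 mul1x.
Qed.

(** Applying the translation that a generator inverts turns the definition of
[phi s] into a product equation in T; its image under [h] is a product with the
same value as if [phi s] were the unit, and the two partial cancellation
properties of [op] at the value [h e] conclude.  [op] need not be a loop
operation: for [oplus] it is not. *)
Lemma Inn_std_generator_compat (I : Type) (h : T -> I) (op : I -> I -> I) phi :
    {morph h : x y / mul x y >-> op x y} ->
    (forall c d, op d c = d -> c = h e) -> (forall c d, op c d = d -> c = h e) ->
  Inn_std_generator mul phi -> forall s, h s = h e -> h (phi s) = h e.
Proof.
move=> hM cancL cancR phi_std s hs.
have [mul1x mulx1 Lbij Rbij] := T_loop.
have hx1 x : op (h x) (h e) = h x by rewrite -hM mulx1.
have h1x x : op (h e) (h x) = h x by rewrite -hM mul1x.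
case: phi_std => [x y|x y|x] /=.
- apply: (cancL _ (h (mul x y))); rewrite -hM.
  by rewrite -/(ltrans _ _ _) inv_mapVK // /ltrans !hM hs hx1.
- apply: (cancR _ (h (mul y x))); rewrite -hM.
  by rewrite -[mul _ (mul y x)]/(rtrans _ _ _) inv_mapVK // /rtrans !hM hs h1x.
- apply: (cancL _ (h x)); rewrite -hM.
  by rewrite -/(ltrans _ _ _) inv_mapVK // /rtrans hM hs h1x.
Qed.

End LoopFacts.

(** * The twisted sum of integers *)

Section Carry.
Variable p : nat.
Hypothesis p_gt0 : (0 < p)%N.

Let pZ_neq0 : (p%:Z != 0). Proof. by rewrite eqz_nat -lt0n. Qed.

Lemma carryC a b : carry p a b = carry p b a.
Proof.
rewrite /carry addrC; case: (boolP (p %| b + a)%Z) => //= pba.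
congr negb; apply/idP/idP => h; move: pba.
  by rewrite (rpredDr b h).
by rewrite (rpredDl a h).
Qed.

Lemma oplusC a b : oplus p a b = oplus p b a.
Proof. by rewrite /oplus carryC [a + b]addrC [(a %/ _)%Z + _]addrC. Qed.

(** When p does not divide [a], a twisted sum is a multiple of p and an
untwisted one is not.  So whether [b] is added with a twist can be read off
[a] and the sum alone. *)
Lemma carryE_oplus a b : carry p a b = ~~ (p %| a)%Z && (p %| oplus p a b)%Z.
Proof.
rewrite /oplus; case: ifPn => [/andP[_ ->]|]; first by rewrite dvdz_mulr.
by rewrite /carry andbC => /negPf ->.
Qed.

Lemma carry0x b : carry p 0 b = false.
Proof. by rewrite /carry dvdz0 andbF. Qed.

Lemma oplus0x b : oplus p 0 b = b.
Proof. by rewrite /oplus carry0x add0r. Qed.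

(** By [carryE_oplus] a twist would require p to divide d, as the sum, and not to
divide d, as the left term; so the sum is the ordinary one. *)
Lemma oplus_eql c d : oplus p d c = d -> c = 0.
Proof.
move=> dc; have := carryE_oplus d c; rewrite dc andNb => ncarry.
by move: dc; rewrite /oplus ncarry -[RHS]addr0 => /addrI.
Qed.

Lemma oplus_eqr c d : oplus p c d = d -> c = 0.
Proof. by rewrite oplusC; apply: oplus_eql. Qed.

(** The parameter t of this description of [b] is the number
(a + b - p) / p that indexes the block in the definition of [Mmul], see
[carry_digit]. *)
Lemma carryP a b :
  reflect (~~ (p %| a)%Z /\ exists t, b = p%:Z * (t + 1) - a) (carry p a b).
Proof.
apply: (iffP andP) => [[/dvdzP[k abE] pNa]|[pNa [t ->]]]; split=> //.
  by exists (k - 1); rewrite subrK mulrC -abE addrC addKr.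
by rewrite addrC subrK dvdz_mulr.
Qed.

Lemma carry_digit a t : ((a + (p%:Z * (t + 1) - a) - p%:Z) %/ p%:Z)%Z = t.
Proof.
have -> : a + (p%:Z * (t + 1) - a) - p%:Z = t * p%:Z by ring.
by rewrite mulzK.
Qed.

Lemma divz_sqr_shift (b s : int) :
  ((p%:Z ^+ 2 * s + b) %/ p%:Z ^+ 2)%Z = s + (b %/ p%:Z ^+ 2)%Z.
Proof. by rewrite mulrC divzMDl // expf_neq0. Qed.

End Carry.

(** * Bijectivity of translations *)

Section Construction.
Variables (p : nat) (p_prime : prime p).
Let p_gt0 := prime_gt0 p_prime.

Lemma intr_Fp_eq (m n : int) : m%:~R = n%:~R :> 'F_p -> (p %| m - n)%Z.
Proof.
by move=> /eqP; rewrite -subr_eq0 -intrB -(dvdz_pcharf (pchar_Fp p_prime)).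
Qed.

Lemma intr_Fp_onto (i : 'F_p) : exists t : int, t%:~R = i.
Proof. by exists (i : nat)%:Z; rewrite -pmulrn natr_Zp. Qed.

(** Together with [carry_onto]: among the [b] that are added to [a] with a
twist, the sum and the residue modulo p of the block index form a complete set
of invariants. *)
Lemma carry_inj a b b' : carry p a b -> carry p a b' ->
  oplus p a b = oplus p a b' ->
  ((a + b - p%:Z) %/ p%:Z)%Z%:~R = ((a + b' - p%:Z) %/ p%:Z)%Z%:~R :> 'F_p ->
  b = b'.
Proof.
move=> ab ab'; rewrite /oplus ab ab'.
have [_ [t bE]] := carryP p a b ab; have [_ [t' b'E]] := carryP p a b' ab'.
have pZ : p%:Z != 0 by rewrite eqz_nat -lt0n.
move/(mulfI pZ)/addrI; rewrite bE b'E !carry_digit // => + /intr_Fp_eq/dvdzP[s tE].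
have -> : p%:Z * (t + 1) - a = p%:Z ^+ 2 * s + (p%:Z * (t' + 1) - a).
  by have -> : t = t' + s * p%:Z by [rewrite -tE addrC subrK]; ring.
rewrite divz_sqr_shift // -[RHS]add0r => /addIr ->.
by rewrite mulr0 add0r.
Qed.

Lemma carry_onto a c (i : 'F_p) : ~~ (p %| a)%Z -> (p %| c)%Z ->
  exists b, [/\ carry p a b, oplus p a b = c &
                ((a + b - p%:Z) %/ p%:Z)%Z%:~R = i].
Proof.
move=> pNa /dvdzP[k ->]; have [t <-] := intr_Fp_onto i.
(* The number p (t + 1) - a has the required residue; the shift by s p^2
   corrects the floor of its quotient by p^2, which has to be k minus that
   of a. *)
pose s := k - (a %/ p%:Z ^+ 2)%Z - ((p%:Z * (t + 1) - a) %/ p%:Z ^+ 2)%Z.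
have bE : p%:Z * ((t + s * p%:Z) + 1) - a
    = p%:Z ^+ 2 * s + (p%:Z * (t + 1) - a) by ring.
exists (p%:Z * ((t + s * p%:Z) + 1) - a).
have ab : carry p a (p%:Z * ((t + s * p%:Z) + 1) - a).
  by apply/carryP; split=> //; eexists.
split=> //; first by rewrite /oplus ab bE divz_sqr_shift // /s; ring.
by rewrite carry_digit // intrD intrM -[p%:Z%:~R]pmulrn pchar_Fp_0 // mulr0 addr0.
Qed.

Variables (Q : Type) (qmul : Q -> Q -> Q) (pi : 'F_p -> Q -> Q).
Hypothesis pi_inj : forall i j x y, pi i x = pi j y -> i = j /\ x = y.
Hypothesis pi_onto : forall z, exists i x, pi i x = z.

Lemma fst_Mmul u v : (Mmul qmul pi u v).1 = oplus p u.1 v.1.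
Proof. by rewrite /Mmul; case: ifP. Qed.

Lemma Mmul0x x b y : Mmul qmul pi (0, x) (b, y) = (b, qmul x y).
Proof. by rewrite /Mmul /= carry0x oplus0x. Qed.

Lemma Mmulx0 a x y : Mmul qmul pi (a, x) (0, y) = (a, qmul x y).
Proof. by rewrite /Mmul /= carryC carry0x oplusC oplus0x. Qed.

(** The hypotheses on [pi] say that the images of the maps [pi i] partition Q.
By [carryE_oplus] the first coordinates of [u] and of the product decide which
clause of [Mmul] applies.  In the twisted one, the second coordinate of the
product determines the residue of the block index and hence [b]. *)
Lemma Mmul_ltrans_bij u : (forall x, bijective (ltrans qmul x)) ->
  bijective (ltrans (Mmul qmul pi) u).
Proof.
case: u => a x Lbij; apply: inj_surj_bijective => [[b y] [b' y']|[c z]].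
  rewrite /ltrans => eqM; have := congr1 fst eqM; rewrite !fst_Mmul /= => eq_op.
  have eq_carry : carry p a b = carry p a b' by rewrite !carryE_oplus eq_op.
  move: eqM; rewrite /Mmul /= eq_carry; case: ifP => ab' [_].
    move/pi_inj => [eq_digit /(bij_inj (Lbij x)) ->].
    by congr pair; apply: (carry_inj (a := a)) => //; rewrite eq_carry.
  move/(bij_inj (Lbij x)) ->; congr pair.
  by move: eq_op; rewrite /oplus eq_carry ab'; apply: addrI.
have Lonto w : exists y, qmul x y = w.
  by have [g _ gK] := Lbij x; exists (g w); apply: gK.
have [/andP[pNa pc]|ac] := boolP (~~ (p %| a)%Z && (p %| c)%Z).
  have [i [w <-]] := pi_onto z; have [y <-] := Lonto w.
  have [b [ab <- <-]] := carry_onto i pNa pc.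
  by exists (b, y); rewrite /ltrans /Mmul /= ab.
have [y <-] := Lonto z; exists (c - a, y).
by rewrite /ltrans /Mmul /oplus /carry /= addrC subrK andbC (negPf ac).
Qed.

End Construction.

(** The opposite of [Mmul] is the same construction over the opposite of Q, as
the twist is symmetric.  This yields right translations from left ones, and
also commutativity. *)
Lemma Mmul_flip (p : nat) (Q : Type) (qmul : Q -> Q -> Q)
    (pi : 'F_p -> Q -> Q) u v :
  Mmul qmul pi u v = Mmul (fun x y => qmul y x) pi v u.
Proof. by rewrite /Mmul carryC oplusC [u.1 + _]addrC. Qed.

(** * The fibre over zero *)

Section Loop.
Variables (p : nat) (p_prime : prime p).
Variables (Q : Type) (qmul : Q -> Q -> Q) (q1 : Q) (pi : 'F_p -> Q -> Q).
Hypothesis Q_loop : is_loop qmul q1.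
Hypothesis pi_inj : forall i j x y, pi i x = pi j y -> i = j /\ x = y.
Hypothesis pi_onto : forall z, exists i x, pi i x = z.

Let M := Mmul qmul pi.
Let S := eq_class (@Msim Q) (0, q1).

Lemma Mmul_loop : is_loop M (0, q1).
Proof.
have [qmul1x qmulx1 Lbij Rbij] := Q_loop.
split=> [[a x]|[a x]|u|u].
- by rewrite /M Mmul0x qmul1x.
- by rewrite /M Mmulx0 qmulx1.
- exact: Mmul_ltrans_bij.
- apply: (@eq_bij _ _ (ltrans (Mmul (fun x y => qmul y x) pi) u)).
    exact: Mmul_ltrans_bij.
  by move=> v; rewrite /ltrans -Mmul_flip.
Qed.

Lemma Msim_multiplicative : multiplicative_equivalence M (@Msim Q).
Proof.
split; first by split=> [u|u v|u v w] //; rewrite /Msim => ->.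
by move=> x y u v; rewrite /Msim /M !fst_Mmul => -> ->.
Qed.

Lemma Msim_classE : S = [set 0] `*` [set: Q].
Proof. by apply/seteqP; split=> [[a x]|[a x] []] /=; rewrite /S /eq_class /Msim /=. Qed.

Lemma Msim_class_pair u : S u -> exists x, u = (0, x).
Proof. by case: u => a x; rewrite /S /eq_class /Msim /= => <-; exists x. Qed.

Lemma Msim_class_subloop : is_subloop M (0, q1) S.
Proof.
have [_ _ Lbij Rbij] := Q_loop.
have [_ _ MLbij MRbij] := Mmul_loop.
split=> // _ /Msim_class_pair[x ->]; split.
- by move=> _ /Msim_class_pair[y ->]; rewrite /ltrans /M Mmul0x.
- by move=> u v _ _; apply: (bij_inj (MLbij _)).
- move=> _ /Msim_class_pair[z ->]; have [g _ gK] := Lbij x.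
  by exists (0, g z) => //; rewrite /ltrans /M Mmul0x; congr pair; apply: gK.
- by move=> _ /Msim_class_pair[y ->]; rewrite /rtrans /M Mmul0x.
- by move=> u v _ _; apply: (bij_inj (MRbij _)).
- move=> _ /Msim_class_pair[z ->]; have [g _ gK] := Rbij x.
  by exists (0, g z) => //; rewrite /rtrans /M Mmul0x; congr pair; apply: gK.
Qed.

Lemma std_generator_Msim_class phi : Inn_std_generator M phi -> phi @` S `<=` S.
Proof.
move=> phi_std _ [s Ss <-]; apply: esym.
apply: (Inn_std_generator_compat Mmul_loop _ _ _ phi_std (esym Ss)).
- exact: fst_Mmul.
- exact: oplus_eql.
- exact: oplus_eqr.
Qed.

(** The factors u and v lie over 1 and -1, whose sum is twisted with block
index -1, so every second coordinate in u (v S) lies in block -1.  The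
preimage of an element of block 0 under translation by uv is then missed. *)
Lemma std_generator_shrinks_class :
  exists2 phi, Inn_std_generator M phi & phi @` S <> S.
Proof.
have [_ _ Lbij _] := Q_loop; have [_ _ MLbij _] := Mmul_loop.
pose u : int * Q := (1, q1); pose v : int * Q := (-1, q1).
have pN1 : ~~ (p %| 1)%Z by rewrite dvdz1 /= gtn_eqF ?prime_gt1.
have c11 : carry p 1 (-1) by rewrite /carry subrr dvdz0.
exists (inv_map (ltrans M (M u v)) \o ltrans M u \o ltrans M v).
  exact: Inn_std_L.
move=> phiS; pose d := oplus p 1 (-1).
have uvE w : M u (-1, w) = (d, pi (-1) (qmul q1 w)).
  have digitN1 : ((1 + -1 - p%:Z) %/ p%:Z)%Z = -1.
    by rewrite subrr add0r -[- p%:Z]mulN1r mulzK // eqz_nat -lt0n prime_gt0.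
  by rewrite /M /Mmul /= c11 /pi_int digitN1.
have vE x : M v (0, x) = (-1, qmul q1 x) by rewrite /M Mmulx0.
have prodE y : M (M u v) (0, y) = (d, qmul (pi (-1) (qmul q1 q1)) y).
  by rewrite uvE /M Mmulx0.
have [g _ gK] := Lbij (pi (-1) (qmul q1 q1)).
have : S (0, g (pi 0 q1)) by [].
rewrite -phiS => -[_ /Msim_class_pair[x ->] /(congr1 (ltrans M (M u v)))] /=.
rewrite inv_mapVK // /ltrans prodE vE uvE -[qmul _ (g _)]/(ltrans _ _ _) gK => -[].
by case/pi_inj => /eqP; rewrite oppr_eq0 oner_eq0.
Qed.

End Loop.

Theorem theorem1p6 (p : nat) (p_prime : prime p)
    (Q : Type) (qmul : Q -> Q -> Q) (q1 : Q)
    (Q_loop : is_loop qmul q1) (Q_infinite : infinite_set [set: Q])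
    (Qi : 'F_p -> set Q) (Qi_partition : partition [set: 'F_p] Qi [set: Q])
    (Qi_card : forall i j : 'F_p, Qi i #= Qi j)
    (pi : 'F_p -> Q -> Q)
    (pi_bij : forall i : 'F_p, set_bij [set: Q] (Qi i) (pi i)) :
  let M := Mmul qmul pi in
  let one : int * Q := (0, q1) in
  let S := eq_class (@Msim Q) one in
  [/\ is_loop M one,
      multiplicative_equivalence M (@Msim Q),
      S = [set 0] `*` [set: Q] &
      [/\ is_subloop M one S,
          ~ is_normal_subloop M one S,
          forall phi, Inn_std_generator M phi -> phi @` S `<=` S &
          exists2 phi, Inn_std_generator M phi & phi @` S <> S]]
  /\ (commutative qmul -> commutative M).
Proof.
move=> M one S; have [Qi_cover Qi_triv _] := Qi_partition.
have pi_in i x : Qi i (pi i x) by have [pi_fun _ _] := pi_bij i; apply: pi_fun.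
have pi_inj i j x y : pi i x = pi j y -> i = j /\ x = y.
  move=> eq_pi; have ij : i = j.
    apply: Qi_triv => //; exists (pi i x); split=> //.
    by rewrite eq_pi.
  split=> //; move: eq_pi; rewrite ij.
  by have [_ pij_inj _] := pi_bij j; apply: pij_inj; rewrite inE.
have pi_onto z : exists i x, pi i x = z.
  have : [set: Q] z by [].
  rewrite -Qi_cover => -[i _ /= Qiz]; have [_ _ pi_surj] := pi_bij i.
  by have [x _ <-] := pi_surj z Qiz; exists i, x.
have M_loop : is_loop M one by apply: Mmul_loop.
split.
  split=> //; [exact: Msim_multiplicative | exact: Msim_classE | split].
  - exact: Msim_class_subloop.
  - have [phi phi_std phiS] : exists2 phi, Inn_std_generator M phi & phi @` S <> S.
      exact: std_generator_shrinks_class.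
    by move=> [_ S_inv]; apply/phiS/S_inv/Inn_std_generator_Inn.
  - exact: std_generator_Msim_class.
  - exact: std_generator_shrinks_class.
move=> qmulC u v; rewrite /M Mmul_flip; congr (Mmul _ _ _ _).
by apply/funext => x; apply/funext => y; rewrite qmulC.
Qed.
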